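(* Let $(\mathcal{M},g)$ be a Riemannian $n$-manifold, $p_0\in\mathcal{M}$, let $\mu$ be a wrapped probability measure centered at $p_0$ with support $\mathcal{X}=\operatorname{supp}\mu$, and let $f:\mathcal{X}\to\mathbb{R}$ be sufficiently smooth, with Riemannian gradient $\nabla_{\mathcal{M}}f$. Let $\iota:\mathcal{M}\hookrightarrow\mathbb{R}^m$ ($m>n$) be an isometric embedding, $\widehat{x}_0=\iota(p_0)$ the central point, $E_0\in\mathbb{R}^{m\times n}$ a matrix whose columns form an orthonormal basis of the central tangent space $T_{\widehat{x}_0}\iota(\mathcal{M})$ in ambient coordinates, and $\pi_0=E_0E_0^{\top}$ the orthogonal projection onto that tangent space. Let $$C_{\iota}=\int_{\mathcal{X}}d\iota[\nabla_{\mathcal{M}}f(p)]\otimes d\iota[\nabla_{\mathcal{M}}f(p)]\,d\mu(p)\in\mathbb{R}^{m\times m}.$$ Then the representation of $C_{\iota}$ on the central tangent space is the second moment of the centrally-projected gradients, $$E_0^{\top}C_{\iota}E_0=\int_{\mathcal{X}}\big(E_0^{\top}d\iota[\nabla_{\mathcal{M}}f(p)]\big)\otimes\big(E_0^{\top}d\iota[\nabla_{\mathcal{M}}f(p)]\big)\,d\mu(p);$$ in particular, for every $\boldsymbol{w}\in\mathbb{R}^n$, with central direction $\widehat{\boldsymbol{w}}=E_0\boldsymbol{w}\in T_{\widehat{x}_0}\iota(\mathcal{M})$, $$\boldsymbol{w}^{\top}\big(E_0^{\top}C_{\iota}E_0\big)\boldsymbol{w}=\int_{\mathcal{X}}\b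ig(\widehat{\boldsymbol{w}}^{\top}\pi_0\,d\iota[\nabla_{\mathcal{M}}f(p)]\big)^2\,d\mu(p).$$
   Context: Wrapped measure: $\mu$ is the pushforward under the exponential map $\exp_{p_0}$ of a Borel probability measure on $T_{p_0}\mathcal{M}$ whose support is star-shaped and lies within the cut locus of $p_0$ (i.e. inside the region bounded by the tangent cut locus), so that each $p\in\mathcal{X}$ is joined to $p_0$ by a unique (minimizing, radial) geodesic. The Riemannian gradient $\nabla_{\mathcal{M}}f(p)\in T_p\mathcal{M}$ is defined by $g_p(\nabla_{\mathcal{M}}f(p),\boldsymbol{v})=df_p[\boldsymbol{v}]$ for all $\boldsymbol{v}\in T_p\mathcal{M}$. ''Sufficiently smooth'' means that $f$ is $C^1$ on a neighborhood of $\mathcal{X}$, with gradient square-integrable with respect to $\mu$ (so $C_\iota$ is well defined). $d\iota[\boldsymbol{v}]\in\mathbb{R}^m$ denotes the image of $\boldsymbol{v}\in T_p\mathcal{M}$ under the differential of $\iota$ at $p$, regarded as a column vector, and $\boldsymbol{u}\otimes\boldsymbol{u}=\boldsymbol{u}\boldsymbol{u}^{\top}$. Isometric embedding means a smooth embedding with $\langle d\iota[\boldsymbol{u}],d\iota[\boldsymbol{v}]\rangle_{\mathbb{R}^m}=g_p(\boldsymbol{u},\boldsymbol{v})$. *)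

(* Defs.v *)
(* Coordinate vectors are columns 'cV[R]_n; tangent spaces are modelled by R^n through a
   preferred chart at each point. *)
From HB Require Import structures.
From mathcomp Require Import all_boot all_order all_algebra.
From mathcomp Require Import all_classical all_reals all_analysis.
Set Implicit Arguments.
Unset Strict Implicit.
Unset Printing Implicit Defensive.
Import Order.TTheory GRing.Theory Num.Theory.
Import numFieldNormedType.Exports.
Local Open Scope classical_set_scope.
Local Open Scope ring_scope.

(* C^k on an open set U; for k > 0 this is the usual notion because V is only ever used
   finite-dimensional, where continuity of x |-> 'd f x can be tested on each vector v. *)
Fixpoint Ck (R : realType) (k : nat) (V W : normedModType R) (U : set V)
    (f : V -> W) {struct k} : Prop :=
  if k is k'.+1 then
    (forall x, U x -> differentiable f x) /\
    (forall v : V, Ck k' U (fun x => 'd f x v))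
  else forall x, U x -> {for x, continuous f}.

(* cmap and cinv are total functions; only their values on cdom and ccod matter. *)
Record chart (R : realType) (n : nat) (M : ptopologicalType) := Chart {
  cdom : set M;
  ccod : set 'cV[R]_n;
  cmap : M -> 'cV[R]_n;
  cinv : 'cV[R]_n -> M;
  cdom_open : open cdom;
  ccod_open : open ccod;
  cmap_cod : forall p, cdom p -> ccod (cmap p);
  cinv_dom : forall x, ccod x -> cdom (cinv x);
  cmapK : forall p, cdom p -> cinv (cmap p) = p;
  cinvK : forall x, ccod x -> cmap (cinv x) = x;
  cmap_continuous : forall p, cdom p -> {for p, continuous cmap};
  cinv_continuous : forall x, ccod x -> {for x, continuous cinv}
}.

Record smooth_structure (R : realType) (n : nat) (M : ptopologicalType) :=
  SmoothStructure {
  manifold_hausdorff : hausdorff_space M;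
  manifold_second_countable : @second_countable M;
  atlas : set (chart R n M);
  chart_at : M -> chart R n M;
  chart_at_atlas : forall p, atlas (chart_at p);
  chart_at_dom : forall p, cdom (chart_at p) p;
  transition_smooth : forall phi psi, atlas phi -> atlas psi ->
    forall k, Ck k (ccod phi `&` cinv phi @^-1` cdom psi) (cmap psi \o cinv phi)
}.

(* A tangent vector at p is identified with its coordinates in the chart chart_at S p. *)
Definition tangent (R : realType) n (M : ptopologicalType)
  (S : smooth_structure R n M) (p : M) := 'cV[R]_n.

Definition mCk (R : realType) n (M : ptopologicalType) (S : smooth_structure R n M)
    (W : normedModType R) (k : nat) (U : set M) (f : M -> W) : Prop :=
  forall phi, atlas S phi ->
    Ck k (ccod phi `&` cinv phi @^-1` U) (f \o cinv phi).

Definition mdiff (R : realType) n (M : ptopologicalType) (S : smooth_structure R n M)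
    (W : normedModType R) (f : M -> W) (p : M) (v : tangent S p) : W :=
  'd (f \o cinv (chart_at S p)) (cmap (chart_at S p) p) v.

(* The tangent vector at cinv phi x whose coordinates in the chart phi are v. *)
Definition of_chart (R : realType) n (M : ptopologicalType) (S : smooth_structure R n M)
    (phi : chart R n M) (x v : 'cV[R]_n) : tangent S (cinv phi x) :=
  'd (cmap (chart_at S (cinv phi x)) \o cinv phi) x v.

Definition evec (R : realType) n (i : 'I_n) : 'cV[R]_n := delta_mx i ord0.

Definition gram_of (R : realType) n (M : ptopologicalType) (S : smooth_structure R n M)
    (g : forall p : M, tangent S p -> tangent S p -> R)
    (phi : chart R n M) (x : 'cV[R]_n) : 'M[R]_n :=
  \matrix_(i < n, j < n)
    g (cinv phi x) (of_chart S phi x (evec R i)) (of_chart S phi x (evec R j)).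

Record riemannian_metric (R : realType) n (M : ptopologicalType)
    (S : smooth_structure R n M) := RiemannianMetric {
  metric :> forall p : M, tangent S p -> tangent S p -> R;
  metric_linear : forall p (a : R) (u v w : 'cV[R]_n),
    @metric p (a *: u + v) w = a * @metric p u w + @metric p v w;
  metric_sym : forall p u v, @metric p u v = @metric p v u;
  metric_pos : forall p (u : 'cV[R]_n), u != 0 -> 0 < @metric p u u;
  metric_smooth : forall phi, atlas S phi ->
    forall k, Ck k (ccod phi) (gram_of (@metric) phi)
}.

Definition gram (R : realType) n (M : ptopologicalType) (S : smooth_structure R n M)
  (g : riemannian_metric S) := gram_of g.

(* Riemannian gradient: the vector representing the differential of f with respect to g. *)
Definition grad (R : realType) n (M : ptopologicalType) (S : smooth_structure R n M)
    (g : riemannian_metric S) (f : M -> R) (p : M) : tangent S p :=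
  xget (0 : 'cV[R]_n)
    [set w : 'cV[R]_n | forall v : tangent S p, g p w v = mdiff f v].

Definition curve_Ck (R : realType) n (M : ptopologicalType) (S : smooth_structure R n M)
    (k : nat) (I : set R) (c : R -> M) : Prop :=
  (forall t, I t -> {for t, continuous c}) /\
  (forall phi, atlas S phi -> Ck k (I `&` c @^-1` cdom phi) (cmap phi \o c)).

Definition velocity (R : realType) n (M : ptopologicalType)
    (S : smooth_structure R n M) (c : R -> M) (t : R) : tangent S (c t) :=
  derive1 (cmap (chart_at S (c t)) \o c) t.

(* C^1 up to the end points, i.e. on a neighbourhood of [a, b]. *)
Definition C1_segment (R : realType) n (M : ptopologicalType)
    (S : smooth_structure R n M) (a b : R) (c : R -> M) : Prop :=
  exists2 e : R, 0 < e & curve_Ck S 1 `]a - e, b + e[ c.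

Definition curve_length (R : realType) n (M : ptopologicalType)
    (S : smooth_structure R n M) (g : riemannian_metric S) (a b : R) (c : R -> M)
    : \bar R :=
  (\int[lebesgue_measure]_(t in `[a, b])
     (Num.sqrt (g (c t) (velocity S c t) (velocity S c t)))%:E)%E.

(* piecewise_C1 g p q l: some piecewise C^1 curve from p to q has length l; the pieces are
   parametrized by [0, 1], which does not affect their lengths. *)
Inductive piecewise_C1 (R : realType) n (M : ptopologicalType)
    (S : smooth_structure R n M) (g : riemannian_metric S)
    : M -> M -> \bar R -> Prop :=
| piecewise_C1_nil p : piecewise_C1 g p p 0%E
| piecewise_C1_cons c q l : C1_segment S 0 1 c -> piecewise_C1 g (c 1) q l ->
    piecewise_C1 g (c 0) q (curve_length g 0 1 c + l)%E.

Definition riemannian_dist (R : realType) n (M : ptopologicalType)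
    (S : smooth_structure R n M) (g : riemannian_metric S) (p q : M) : \bar R :=
  ereal_inf [set l | piecewise_C1 g p q l].

Definition christoffel (R : realType) n (M : ptopologicalType)
    (S : smooth_structure R n M) (g : riemannian_metric S)
    (phi : chart R n M) (x : 'cV[R]_n) (k i j : 'I_n) : R :=
  let dG (l a b : 'I_n) := 'd (fun y => gram g phi y a b : R) x (evec R l) in
  2^-1 * \sum_(l < n) invmx (gram g phi x) k l * (dG i j l + dG j i l - dG l i j).

(* Geodesic for the Levi-Civita connection, by the geodesic equation in every chart. *)
Definition geodesic (R : realType) n (M : ptopologicalType)
    (S : smooth_structure R n M) (g : riemannian_metric S) (I : set R)
    (c : R -> M) : Prop :=
  (forall k, curve_Ck S k I c) /\
  (forall phi, atlas S phi -> forall t, I t -> cdom phi (c t) ->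
    let x := cmap phi \o c in
    forall k : 'I_n,
      (derive1 (derive1 x) t) k ord0 +
      \sum_(i < n) \sum_(j < n) christoffel g phi (x t) k i j *
        (derive1 x t) i ord0 * (derive1 x t) j ord0 = 0).

Definition geodesic_from (R : realType) n (M : ptopologicalType)
    (S : smooth_structure R n M) (g : riemannian_metric S) (p : M)
    (v : tangent S p) (b : R) (c : R -> M) : Prop :=
  (exists2 e : R, 0 < e & geodesic g `]- e, b + e[ c) /\
  c 0 = p /\ velocity S c 0 = v :> 'cV[R]_n.

(* Exponential map; (M, g) need not be complete, and where exp is undefined the value is
   the dummy p. *)
Definition exp_map (R : realType) n (M : ptopologicalType)
    (S : smooth_structure R n M) (g : riemannian_metric S) (p : M)
    (v : tangent S p) : M :=
  xget p [set q | exists2 c, geodesic_from g v 1 c & q = c 1].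
Arguments exp_map {R n M S} g p v.

(* The region of T_p M strictly inside the tangent cut locus: the cut time of the geodesic
   with initial velocity v, i.e. the supremum of the b for which it is minimizing on
   [0, b], exceeds 1. *)
Definition inside_cut_locus (R : realType) n (M : ptopologicalType)
    (S : smooth_structure R n M) (g : riemannian_metric S) (p : M)
    : set (tangent S p) :=
  [set v | exists b : R, 1 < b /\ exists2 c, geodesic_from g v b c &
     curve_length g 0 b c = riemannian_dist g p (c b)].
Arguments inside_cut_locus {R n M S} g p.

Notation borel T := (g_sigma_algebraType (@open T)).

(* Topological support. *)
Definition supp (R : realType) (T : ptopologicalType) (mu : set (borel T) -> \bar R)
    : set T :=
  [set x | forall U : set T, open U -> U x -> (0 < mu U)%E].

Definition star_shaped (R : realType) (V : lmodType R) (A : set V) : Prop :=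
  forall (v : V) (t : R), A v -> 0 <= t <= 1 -> A (t *: v).

Definition wrapped_measure (R : realType) n (M : ptopologicalType)
    (S : smooth_structure R n M) (g : riemannian_metric S) (p0 : M)
    (mu : probability (borel M) R) : Prop :=
  exists nu : probability (borel (tangent S p0)) R,
    [/\ star_shaped (supp nu), supp nu `<=` inside_cut_locus g p0 &
        forall A : set (borel M), measurable A ->
          mu A = pushforward nu (exp_map g p0 : borel (tangent S p0) -> borel M) A].

Record isometric_embedding (R : realType) n m (M : ptopologicalType)
    (S : smooth_structure R n M) (g : riemannian_metric S)
    (iota : M -> 'cV[R]_m) : Prop := IsometricEmbedding {
  embedding_smooth : forall k, mCk S k setT iota;
  embedding_injective : injective iota;
  embedding_homeo : forall U : set M, open U ->
    exists2 V : set 'cV[R]_m, open V & U = iota @^-1` V;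
  embedding_immersion : forall p, injective (mdiff (S := S) iota (p := p));
  embedding_isometric : forall p (u v : tangent S p),
    \sum_(i < m) mdiff iota u i ord0 * mdiff iota v i ord0 = g p u v
}.

(* The tangent space of iota(M) at iota p, as a linear subspace of R^m. *)
Definition embedded_tangent (R : realType) n m (M : ptopologicalType)
    (S : smooth_structure R n M) (iota : M -> 'cV[R]_m) (p : M) : set 'cV[R]_m :=
  [set mdiff iota v | v in [set: tangent S p]].

Definition orthonormal_basis_of (R : realType) m n (T : set 'cV[R]_m)
    (E : 'M[R]_(m, n)) : Prop :=
  E^T *m E = 1%:M /\ [set E *m w | w in [set: 'cV[R]_n]] = T.

Definition outer (R : realType) m (u : 'cV[R]_m) : 'M[R]_m := u *m u^T.

Definition mx_integral (R : realType) (d : measure_display) (T : measurableType d)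
    (mu : {measure set T -> \bar R}) (D : set T) m n (F : T -> 'M[R]_(m, n))
    : 'M[R]_(m, n) :=
  \matrix_(i < m, j < n) \int[mu]_(x in D) (F x i j).

(* f is C^1 on a neighbourhood of X, with mu-square-integrable gradient on X. *)
Definition sufficiently_smooth (R : realType) n (M : ptopologicalType)
    (S : smooth_structure R n M) (g : riemannian_metric S)
    (mu : probability (borel M) R) (X : set M) (f : M -> R) : Prop :=
  (exists U : set M, [/\ open U, X `<=` U & mCk S 1 U f]) /\
  mu.-integrable X (fun p => (g p (grad g f p) (grad g f p))%:E).

Definition gradient_moment (R : realType) n m (M : ptopologicalType)
    (S : smooth_structure R n M) (g : riemannian_metric S)
    (mu : probability (borel M) R) (f : M -> R) (iota : M -> 'cV[R]_m) : 'M[R]_m :=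
  mx_integral mu (supp mu) (fun p => outer (mdiff iota (grad g f p))).

(* Main.v *)
(** Write u for the embedded gradient.  Once the entries of u u^T are known to be
    mu-integrable, both identities are linearity of the integral.  The products
    u_i u_j are dominated by |u|^2 = g(grad f, grad f), which is integrable by
    hypothesis, so the point is measurability: in any chart,
    u = A (A^T A)^-1 b, where A is the Jacobian of iota and b the vector of partial
    derivatives of f.  This expression is unchanged under a change of chart
    (A, b) |-> (A L, L^T b), hence near a given point it may be computed in one fixed
    chart although [tangent] uses a different chart at every point, and u is continuous
    on the open set where f is C^1. *)
Require Import Defs.
From HB Require Import structures.
From mathcomp Require Import all_boot all_order all_algebra.
From mathcomp Require Import all_classical all_reals all_analysis.
From mathcomp Require Import measurable_realfun lra.
Set Implicit Arguments.
Unset Strict Implicit.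
Unset Printing Implicit Defensive.
Import Order.TTheory GRing.Theory Num.Theory.
Import numFieldNormedType.Exports.
Local Open Scope classical_set_scope.
Local Open Scope ring_scope.

(** * Linear algebra of the normal equations *)

Section NormalEquations.
Context {R : realFieldType}.

(** If [v] annihilates the Gram matrix, then [A *m v^T] has zero sum of squares, hence vanishes. *)
Lemma gram_unit (m n : nat) (A : 'M[R]_(m, n)) :
  injective (mulmx A : 'cV[R]_n -> 'cV[R]_m) -> A^T *m A \in unitmx.
Proof.
move=> Ainj; rewrite -row_free_unit; apply: inj_row_free => v vG.
suff /Ainj vT0 : A *m v^T = A *m 0 by rewrite -[v]trmxK vT0 trmx0.
rewrite mulmx0; apply/matrixP => i j; rewrite ord1 [RHS]mxE.
have : ((A *m v^T)^T *m (A *m v^T)) 0 0 = 0.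
  by rewrite trmx_mul trmxK mulmxA -(mulmxA v) vG mul0mx mxE.
rewrite mxE; under eq_bigr do rewrite [X in X * _]mxE -expr2.
move/eqP; rewrite psumr_eq0; last by move=> k _; exact: sqr_ge0.
by move=> /allP /(_ i); rewrite mem_index_enum sqrf_eq0 => /(_ isT) /eqP.
Qed.

(** If [w] solves the normal equations for [A *m L], cancelling [L^T] shows that [L *m w] solves
    those for [A]. Invertibility of [L] and of [A^T *m A] is read off the factorization of the
    invertible Gram matrix of [A *m L]. *)
Lemma gram_solution_change_basis (m n : nat) (A : 'M[R]_(m, n)) (L : 'M[R]_n)
    (b : 'cV[R]_n) :
  injective (mulmx (A *m L) : 'cV[R]_n -> 'cV[R]_m) ->
  [/\ injective (mulmx A : 'cV[R]_n -> 'cV[R]_m) &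
   A *m L *m (invmx ((A *m L)^T *m (A *m L)) *m (L^T *m b)) =
   A *m (invmx (A^T *m A) *m b)].
Proof.
move=> ALinj.
have ALU := gram_unit ALinj.
have GE : (A *m L)^T *m (A *m L) = L^T *m (A^T *m A) *m L.
  by rewrite trmx_mul !mulmxA.
have LU : L \in unitmx by move: ALU; rewrite GE unitmx_mul => /andP[].
have LTU : L^T \in unitmx by rewrite unitmx_tr.
have AU : A^T *m A \in unitmx.
  by move: ALU; rewrite GE !unitmx_mul => /andP[/andP[_ ->]].
split.
  move=> v w /(congr1 (mulmx A^T)); rewrite !mulmxA.
  by move=> /(congr1 (mulmx (invmx (A^T *m A)))); rewrite !mulKmx.
rewrite -[A *m L *m _]mulmxA; congr (A *m _).
apply: (canRL (mulKmx AU)).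
set w := invmx _ *m _.
have H : L^T *m (A^T *m A *m (L *m w)) = L^T *m b.
  by rewrite (mulmxA L^T) (mulmxA _ L) -GE /w mulKVmx.
by move/(congr1 (mulmx (invmx L^T))): H; rewrite !mulKmx.
Qed.

End NormalEquations.

(** * Limits of matrix products, determinants and inverses *)

Section EntrywiseConvergence.
Context {R : realType} {T : Type} {F : set_system T} {FF : Filter F}.

Definition mx_cvg (m n : nat) (A : T -> 'M[R]_(m, n)) (l : 'M[R]_(m, n)) :=
  forall i j, (fun t => A t i j) @ F --> l i j.

Lemma mx_cvg_tr (m n : nat) (A : T -> 'M[R]_(m, n)) l :
  mx_cvg A l -> mx_cvg (fun t => (A t)^T) l^T.
Proof. by move=> Al i j; under eq_fun do rewrite mxE; rewrite mxE; exact: Al. Qed.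

Lemma mx_cvg_mul (m n p : nat) (A : T -> 'M[R]_(m, n)) (B : T -> 'M[R]_(n, p)) a b :
  mx_cvg A a -> mx_cvg B b -> mx_cvg (fun t => A t *m B t) (a *m b).
Proof.
move=> Aa Bb i j; under eq_fun do rewrite mxE; rewrite mxE.
apply: cvg_big => [|k _]; first exact: add_continuous.
by apply: cvgM; [exact: Aa|exact: Bb].
Qed.

Lemma cvg_det (n : nat) (A : T -> 'M[R]_n) a :
  mx_cvg A a -> \det (A t) @[t --> F] --> \det a.
Proof.
move=> Aa; apply: cvg_big => [|s _]; first exact: add_continuous.
apply: cvgM; first exact: cvg_cst.
apply: cvg_big => [|i _]; first exact: mul_continuous.
exact: Aa.
Qed.

Lemma mx_cvg_adj (n : nat) (A : T -> 'M[R]_n) a :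
  mx_cvg A a -> mx_cvg (fun t => \adj (A t)) (\adj a).
Proof.
move=> Aa i j; under eq_fun do rewrite mxE; rewrite mxE /cofactor.
apply: cvgM; first exact: cvg_cst.
apply: cvg_det => k l; under eq_fun do rewrite !mxE; rewrite !mxE; exact: Aa.
Qed.

(** Cramer's rule makes each entry of the inverse a quotient of polynomials in the entries. [invmx]
    returns its argument on singular matrices, so the formula is only available where [A t] is
    invertible. *)
Lemma mx_cvg_inv (n : nat) (A : T -> 'M[R]_n) a :
  (\forall t \near F, A t \in unitmx) -> a \in unitmx ->
  mx_cvg A a -> mx_cvg (fun t => invmx (A t)) (invmx a).
Proof.
move=> AU aU Aa i j.
have -> : invmx a i j = (\det a)^-1 * (\adj a) i j by rewrite /invmx aU !mxE.
have cvg_formula : (\det (A t))^-1 * (\adj (A t)) i j @[t --> F] -->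
    (\det a)^-1 * (\adj a) i j.
  apply: cvgM; last exact: mx_cvg_adj.
  by apply: cvgV; [rewrite -unitfE -unitmxE|exact: cvg_det].
apply: cvg_trans cvg_formula; apply: near_eq_cvg.
by apply: filterS AU => t AtU; rewrite /invmx AtU !mxE.
Qed.

End EntrywiseConvergence.
Arguments mx_cvg {R T} F {m n} A l.

(** * Differentials as matrices *)

Section LinearMapsOnColumns.
Context {R : realType} {n : nat}.

Lemma linear_colE (W : lmodType R) (h : {linear 'cV[R]_n -> W}) (v : 'cV[R]_n) :
  h v = \sum_(j < n) v j ord0 *: h (evec R j).
Proof.
rewrite [in LHS](matrix_sum_delta v) linear_sum; apply: eq_bigr => j _.
by rewrite big_ord1 linearZ.
Qed.

Definition jac (m : nat) (F : 'cV[R]_n -> 'cV[R]_m) (x : 'cV[R]_n) : 'M[R]_(m, n) :=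
  \matrix_(i < m, j < n) ('d F x (evec R j) i ord0).

Definition partials (F : 'cV[R]_n -> R) (x : 'cV[R]_n) : 'cV[R]_n :=
  \col_(j < n) ('d F x (evec R j)).

Lemma diff_jac (m : nat) (F : 'cV[R]_n -> 'cV[R]_m) (x v : 'cV[R]_n) :
  'd F x v = jac F x *m v.
Proof.
rewrite linear_colE; apply/matrixP => i j; rewrite (ord1 j) summxE [RHS]mxE.
by apply: eq_bigr => k _; rewrite !mxE mulrC.
Qed.

Lemma diff_partials (F : 'cV[R]_n -> R) (x v : 'cV[R]_n) :
  'd F x v = ((partials F x)^T *m v) ord0 ord0.
Proof.
rewrite linear_colE [RHS]mxE.
by apply: eq_bigr => k _; rewrite !mxE mulrC.
Qed.

End LinearMapsOnColumns.

(** * Change of chart for differentials *)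

Section Charts.
Context {R : realType} {n : nat} {M : ptopologicalType} (S : smooth_structure R n M).

(** The chain rule through the transition map from the preferred chart of [q] to [phi]. *)
Lemma mdiff_chart (W : normedModType R) (U : set M) (h : M -> W) (phi : chart R n M)
    (q : M) (v : tangent S q) :
  mCk S 1 U h -> atlas S phi -> cdom phi q -> U q ->
  mdiff h v = 'd (h \o cinv phi) (cmap phi q)
    ('d (cmap phi \o cinv (chart_at S q)) (cmap (chart_at S q) q) v).
Proof.
move=> hU aphi phiq Uq; rewrite /mdiff.
set psi := chart_at S q; set y := cmap psi q.
have apsi : atlas S psi := chart_at_atlas S q.
have psiq : cdom psi q := chart_at_dom S q.
have yq : cinv psi y = q by rewrite /y cmapK.
have ypsi : ccod psi y by exact: cmap_cod.
have dT : differentiable (cmap phi \o cinv psi) y.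
  by have [dT _] := transition_smooth apsi aphi 1; apply: dT; split=> //=; rewrite yq.
have dh : differentiable (h \o cinv psi) y.
  by have [dh _] := hU psi apsi; apply: dh; split=> //=; rewrite yq.
have dhphi : differentiable (h \o cinv phi) ((cmap phi \o cinv psi) y).
  have [dhphi _] := hU phi aphi; apply: dhphi; rewrite /= yq.
  by split => //=; [exact: cmap_cod|rewrite cmapK].
have <- : (cmap phi \o cinv psi) y = cmap phi q by rewrite /= yq.
transitivity ('d ((h \o cinv phi) \o (cmap phi \o cinv psi)) y v); last first.
  exact: (congr1 (fun F => F v) (diff_comp dT dhphi)).
(* The two functions need only agree at points sent into [cdom phi], that is, near [y]; directional
   derivatives depend on the germ alone. *)
rewrite -!deriveE //; last exact: differentiable_comp.
apply: near_eq_derive.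
have near_dom : \forall z \near y, cdom phi (cinv psi z).
  apply: (cinv_continuous ypsi); apply: open_nbhs_nbhs.
  by split; [exact: cdom_open|rewrite yq].
by apply: filterS near_dom => z /= zphi; rewrite cmapK.
Qed.

(** The chart and the vector [v] stay fixed as [z] varies, so the continuity contained in [Ck 1]
    applies after composition with [cmap phi]. *)
Lemma diff_chart_continuous (W : normedModType R) (U : set M) (h : M -> W)
    (phi : chart R n M) (q : M) (v : 'cV[R]_n) :
  mCk S 1 U h -> atlas S phi -> cdom phi q -> U q ->
  'd (h \o cinv phi) (cmap phi z) v @[z --> q] --> 'd (h \o cinv phi) (cmap phi q) v.
Proof.
move=> hU aphi phiq Uq; have [_ /(_ v) /= dcont] := hU phi aphi.
apply: (@cvg_comp _ _ _ (cmap phi) (fun x => 'd (h \o cinv phi) x v)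
  _ (nbhs (cmap phi q))); first exact: cmap_continuous.
by apply: dcont; split; [exact: cmap_cod|rewrite /= cmapK].
Qed.

End Charts.

(** * The embedded gradient in a fixed chart, its continuity and its norm *)

Section EmbeddedGradient.
Context {R : realType} {n m : nat} {M : ptopologicalType}.
Context {S : smooth_structure R n M} (g : riemannian_metric S).
Context (iota : M -> 'cV[R]_m) (hiota : isometric_embedding g iota).
Context (U : set M) (f : M -> R) (fU : mCk S 1 U f).

(** For an isometric [iota], [A^T *m A] is the metric in the coordinates of [phi]: the inner factor
    is the classical $g^{ij}\partial_j f$, and [A] pushes it forward to the ambient space. *)
Definition chart_gradient (phi : chart R n M) (x : 'cV[R]_n) : 'cV[R]_m :=
  let A := jac (iota \o cinv phi) x in
  A *m (invmx (A^T *m A) *m partials (f \o cinv phi) x).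

(** [L] is the Jacobian of the transition map; the same [L] must serve [iota] and [f] for it to
    cancel in the gradient. *)
Lemma mdiff_embedding_chart (phi : chart R n M) (q : M) :
  atlas S phi -> cdom phi q ->
  exists L : 'M[R]_n,
    (forall v : tangent S q,
       mdiff iota v = jac (iota \o cinv phi) (cmap phi q) *m L *m v) /\
    (U q -> forall v : tangent S q,
       mdiff f v =
       ((L^T *m partials (f \o cinv phi) (cmap phi q))^T *m v) ord0 ord0).
Proof.
move=> aphi phiq.
exists (jac (cmap phi \o cinv (chart_at S q)) (cmap (chart_at S q) q)); split.
  move=> v; rewrite (mdiff_chart v (embedding_smooth hiota 1) aphi phiq) //.
  by rewrite !diff_jac mulmxA.
move=> Uq v; rewrite (mdiff_chart v fU aphi phiq Uq).
by rewrite diff_jac diff_partials trmx_mul trmxK mulmxA.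
Qed.

Lemma jac_embedding_injective (phi : chart R n M) (q : M) :
  atlas S phi -> cdom phi q ->
  injective (mulmx (jac (iota \o cinv phi) (cmap phi q)) : 'cV[R]_n -> 'cV[R]_m).
Proof.
move=> aphi phiq; have [L [iotaE _]] := mdiff_embedding_chart aphi phiq.
(* The right-hand side [0] is a dummy: only the injectivity half of the conclusion is wanted. *)
suff /(gram_solution_change_basis 0)[] : injective
    (mulmx (jac (iota \o cinv phi) (cmap phi q) *m L) : 'cV[R]_n -> 'cV[R]_m) by [].
by move=> v w; rewrite -!iotaE => /(embedding_immersion hiota).
Qed.

(** In the preferred chart of [q] the metric is [G] and the differential of [f] is [L^T *m b], so
    the gradient solves the normal equations for [A *m L]; the change of basis removes [L]. *)
Lemma embedded_gradE (phi : chart R n M) (q : M) :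
  atlas S phi -> cdom phi q -> U q ->
  mdiff iota (grad g f q) = chart_gradient phi (cmap phi q).
Proof.
move=> aphi phiq Uq; have [L [iotaE]] := mdiff_embedding_chart aphi phiq.
move=> /(_ Uq) fE.
rewrite /chart_gradient; set A := jac _ _ in iotaE *; set b := partials _ _ in fE *.
have ALinj : injective (mulmx (A *m L) : 'cV[R]_n -> 'cV[R]_m).
  by move=> v w; rewrite -!iotaE => /(embedding_immersion hiota).
have [_ <-] := gram_solution_change_basis b ALinj.
set G := (A *m L)^T *m (A *m L).
have GU : G \in unitmx := gram_unit ALinj.
have GT : G^T = G by rewrite /G trmx_mul trmxK.
have gE (v w : tangent S q) : g q v w = (v^T *m G *m w) ord0 ord0.
  rewrite -(embedding_isometric hiota) /G mulmxA -mulmxA -trmx_mul mxE.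
  by apply: eq_bigr => i _; rewrite !iotaE !mxE.
suff -> : grad g f q = invmx G *m (L^T *m b) :> 'cV[R]_n by rewrite iotaE.
(* A vector picked by [xget] is determined by testing on the basis vectors; the default case is
   excluded because [invmx G *m (L^T *m b)] represents the differential. *)
rewrite /grad; case: xgetP => [w _ /= wE|/(_ (invmx G *m (L^T *m b))) /= []].
  have : w^T *m G = (L^T *m b)^T.
    apply/rowP => j; have := wE (evec R j).
    by rewrite gE fE -!colE !mxE.
  by move/(congr1 trmx); rewrite trmx_mul !trmxK GT => <-; rewrite mulKmx.
by move=> v; rewrite gE fE trmx_mul trmx_inv GT mulmxKV.
Qed.

Lemma embedded_grad_continuous (q : M) (i : 'I_m) : open U -> U q ->
  {for q, continuous (fun p => mdiff iota (grad g f p) i ord0)}.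
Proof.
move=> oU Uq; pose phi := chart_at S q.
have aphi : atlas S phi := chart_at_atlas S q.
have phiq : cdom phi q := chart_at_dom S q.
have near_phi : \forall p \near q, cdom phi p.
  by apply: open_nbhs_nbhs; split => //; exact: cdom_open.
have near_U : \forall p \near q, U p by exact: open_nbhs_nbhs.
rewrite /prop_for /continuous_at (embedded_gradE aphi phiq Uq).
have cvg_chart : mx_cvg (nbhs q) (chart_gradient phi \o cmap phi)
    (chart_gradient phi (cmap phi q)).
  have cvgA : mx_cvg (nbhs q) (fun p => jac (iota \o cinv phi) (cmap phi p))
      (jac (iota \o cinv phi) (cmap phi q)).
    move=> k l; under eq_fun do rewrite mxE; rewrite mxE.
    apply: (@cvg_comp _ _ _ _ (fun w : 'cV[R]_m => w k ord0)
      _ (nbhs ('d (iota \o cinv phi) (cmap phi q) (evec R l)))).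
      exact: diff_chart_continuous (embedding_smooth hiota 1) aphi phiq I.
    exact: coord_continuous.
  have gramU p : cdom phi p ->
      (jac (iota \o cinv phi) (cmap phi p))^T *m jac (iota \o cinv phi) (cmap phi p)
        \in unitmx.
    by move=> phip; apply/gram_unit/jac_embedding_injective.
  apply: mx_cvg_mul => //; apply: mx_cvg_mul.
    apply: mx_cvg_inv; [exact: filterS near_phi|exact: gramU|].
    by apply: mx_cvg_mul => //; exact: mx_cvg_tr.
  move=> k l; under eq_fun do rewrite mxE; rewrite mxE.
  exact: diff_chart_continuous fU aphi phiq Uq.
(* The chart formula equals the embedded gradient on the intersection of [cdom phi] and [U], a
   neighbourhood of [q]. *)
apply: cvg_trans (cvg_chart i ord0); apply: near_eq_cvg.
by apply: filterS2 near_phi near_U => p phip Up /=; rewrite (embedded_gradE aphi).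
Qed.

Lemma embedded_grad_norm (q : M) (i : 'I_m) :
  mdiff iota (grad g f q) i ord0 ^+ 2 <= g q (grad g f q) (grad g f q).
Proof.
rewrite -(embedding_isometric hiota) (bigD1 i) //= -expr2 lerDl.
by apply: sumr_ge0 => k _; rewrite -expr2 sqr_ge0.
Qed.

End EmbeddedGradient.

(** * Measurability and entrywise integration of matrices *)

Section Integrals.
Context {R : realType}.

Lemma continuous_on_open_measurable (T : ptopologicalType) (U : set T) (h : T -> R) :
  open U -> (forall p, U p -> {for p, continuous h}) ->
  measurable_fun (U : set (borel T)) (h : borel T -> R).
Proof.
move=> oU ch; apply: (measurability _ (RGenOpens.measurableE R)).
move=> _ [_ [a [b ->] <-]]; apply: sub_sigma_algebra.
rewrite openE => p [Up /= hp]; apply: filterI.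
  by apply: open_nbhs_nbhs; split.
by apply: (ch p Up); apply: open_nbhs_nbhs; split.
Qed.

(** The support is closed: an open null neighbourhood of a point outside it excludes all of its own
    points too. *)
Lemma supp_measurable (T : ptopologicalType) (mu : {measure set (borel T) -> \bar R}) :
  measurable (supp mu : set (borel T)).
Proof.
rewrite -[supp mu]setCK; apply: measurableC; apply: sub_sigma_algebra.
have interior_open (A : set T) : A `<=` A° -> open A by rewrite openE.
apply: interior_open => p /existsNP[V /not_implyP[oV /not_implyP[Vp Vmu]]].
apply: filterS (open_nbhs_nbhs (conj oV Vp)) => q Vq.
by move=> /(_ V oV Vq).
Qed.

Context {d : measure_display} {T : measurableType d} (mu : {measure set T -> \bar R}).
Context (D : set T) (mD : measurable D).

Lemma Rintegral_sum (I : Type) (s : seq I) (F : I -> T -> R) :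
  (forall i, mu.-integrable D (EFin \o F i)) ->
  \int[mu]_(x in D) (\sum_(i <- s) F i x) = \sum_(i <- s) \int[mu]_(x in D) F i x.
Proof.
move=> iF; elim: s => [|i s IHs].
  by rewrite big_nil; under eq_Rintegral do rewrite big_nil; rewrite Rintegral_cst// mul0r.
rewrite big_cons -IHs -RintegralD//; last first.
  rewrite (_ : _ \o _ = fun x => \sum_(i <- s) (F i x)%:E)%E; last first.
    by apply/funext => x /=; rewrite sumEFin.
  by apply: integrable_sum => // j _; exact: iF.
by apply: eq_Rintegral => x _; rewrite big_cons.
Qed.

Definition mx_integrable (m n : nat) (F : T -> 'M[R]_(m, n)) :=
  forall i j, mu.-integrable D (fun x => (F x i j)%:E).

Lemma mx_integrable_mull (k m n : nat) (L : 'M[R]_(k, m)) (F : T -> 'M[R]_(m, n)) :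
  mx_integrable F -> mx_integrable (fun x => L *m F x).
Proof.
move=> iF i j.
rewrite (_ : (fun _ => _) = fun x => \sum_(l < m) (L i l)%:E * (F x l j)%:E)%E.
  by apply: integrable_sum => // l _; exact: integrableZl.
by apply/funext => x; rewrite mxE -sumEFin.
Qed.

Lemma mx_integral_mull (k m n : nat) (L : 'M[R]_(k, m)) (F : T -> 'M[R]_(m, n)) :
  mx_integrable F -> mx_integral mu D (fun x => L *m F x) = L *m mx_integral mu D F.
Proof.
move=> iF; apply/matrixP => i j; rewrite !mxE.
under eq_Rintegral do rewrite mxE.
rewrite Rintegral_sum => [|l]; last exact: (integrableZl mD (L i l) (iF l j)).
by apply: eq_bigr => l _; rewrite mxE RintegralZl//; exact: iF.
Qed.

Lemma mx_integral_tr (m n : nat) (F : T -> 'M[R]_(m, n)) :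
  mx_integral mu D (fun x => (F x)^T) = (mx_integral mu D F)^T.
Proof.
by apply/matrixP => i j; rewrite !mxE; apply: eq_Rintegral => x _; rewrite mxE.
Qed.

Lemma mx_integral_mulr (m n p : nat) (F : T -> 'M[R]_(m, n)) (N : 'M[R]_(n, p)) :
  mx_integrable F -> mx_integral mu D (fun x => F x *m N) = mx_integral mu D F *m N.
Proof.
move=> iF; apply: trmx_inj; rewrite -mx_integral_tr trmx_mul -mx_integral_tr.
rewrite -mx_integral_mull; first by under eq_fun do rewrite trmx_mul.
by move=> i j; under eq_fun do rewrite mxE; exact: iF.
Qed.

(** Both identities of the theorem are instances: [L] is [E0^T] for the matrix one and the row
    [what^T] for the quadratic form. *)
Lemma mx_integral_outer (m n : nat) (u : T -> 'cV[R]_m) (L : 'M[R]_(n, m)) :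
  mx_integrable (fun x => outer (u x)) ->
  L *m mx_integral mu D (fun x => outer (u x)) *m L^T =
  mx_integral mu D (fun x => outer (L *m u x)).
Proof.
move=> iu; rewrite -mx_integral_mull// -mx_integral_mulr; last exact: mx_integrable_mull.
by congr mx_integral; apply/funext => x; rewrite /outer trmx_mul !mulmxA.
Qed.

(** Domination by [G] follows from $2|u_i u_j| \le u_i^2 + u_j^2$, i.e. from the squares of $u_i \pm
    u_j$ being nonnegative. *)
Lemma mx_integrable_outer (m : nat) (u : T -> 'cV[R]_m) (G : T -> R) :
  (forall i, measurable_fun D (fun x => u x i ord0)) ->
  (forall i x, D x -> u x i ord0 ^+ 2 <= G x) ->
  mu.-integrable D (EFin \o G) -> mx_integrable (fun x => outer (u x)).
Proof.
move=> mu_u uG iG i j.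
have outerE x : outer (u x) i j = u x i ord0 * u x j ord0.
  by rewrite /outer mxE big_ord1 mxE.
under eq_fun do rewrite outerE.
apply: (le_integrable mD _ _ iG).
  by apply/measurable_EFinP; exact: measurable_funM.
move=> x Dx; rewrite /= lee_fin; apply: le_trans (ler_norm _).
have ui := uG i x Dx; have uj := uG j x Dx.
rewrite ler_norml; apply/andP; split.
  by have := sqr_ge0 (u x i ord0 + u x j ord0); nra.
by have := sqr_ge0 (u x i ord0 - u x j ord0); nra.
Qed.

End Integrals.


Theorem theorem1 (R : realType) (n m : nat) (hnm : (n < m)%N)
    (M : ptopologicalType) (S : smooth_structure R n M) (g : riemannian_metric S)
    (p0 : M) (mu : probability (borel M) R) (hmu : wrapped_measure g p0 mu)
    (f : M -> R) (hf : sufficiently_smooth g mu (supp mu) f)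
    (iota : M -> 'cV[R]_m) (hiota : isometric_embedding g iota)
    (E0 : 'M[R]_(m, n))
    (hE0 : orthonormal_basis_of (embedded_tangent S iota p0) E0) :
  let X := supp mu in
  let u := fun p : M => mdiff iota (grad g f p) in
  let C := gradient_moment g mu f iota in
  let pi0 := E0 *m E0^T in
  E0^T *m C *m E0 = mx_integral mu X (fun p => outer (E0^T *m u p)) /\
  (forall w : 'cV[R]_n,
     let what := E0 *m w in
     embedded_tangent S iota p0 what /\
     (w^T *m (E0^T *m C *m E0) *m w) ord0 ord0 =
       \int[mu]_(p in X) ((what^T *m pi0 *m u p) ord0 ord0) ^+ 2).
Proof.
move=> X u C pi0.
have [[U [oU XU fU]] iG] := hf.
have mX : measurable (X : set (borel M)) by exact: supp_measurable.
have iu : mx_integrable mu X (fun p => outer (u p)).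
  apply: mx_integrable_outer iG => // [i|i p _]; last exact: embedded_grad_norm.
  (* Continuity gives measurability on the open set [U], which then restricts to the support. *)
  have mU : measurable (U : set (borel M)) by exact: sub_sigma_algebra.
  have mui := continuous_on_open_measurable oU
    (fun p => @embedded_grad_continuous _ _ _ _ _ g _ hiota _ _ fU p i oU).
  exact: measurable_funS mU XU mui.
have CE : E0^T *m C *m E0 = mx_integral mu X (fun p => outer (E0^T *m u p)).
  by rewrite -mx_integral_outer// trmxK.
split=> // w what; have [E0E0 <-] := hE0; split; first by exists w.
have -> : w^T *m (E0^T *m C *m E0) *m w = what^T *m C *m what^T^T.
  by rewrite trmxK /what trmx_mul !mulmxA.
(* The projection fixes central directions, since the columns of [E0] are orthonormal. *)
have -> : what^T *m pi0 = what^T.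
  by rewrite /what /pi0 trmx_mul mulmxA -(mulmxA w^T) E0E0 mulmx1.
(* With [L] a single row, the outer product is a 1 by 1 matrix whose entry is the square in the
   integrand. *)
rewrite mx_integral_outer// mxE; apply: eq_Rintegral => p _.
by rewrite /outer mxE big_ord1 [X in _ * X]mxE -expr2.
Qed.
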